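(* Suppose $Q=\{\mathbf{x}\in\mathbb{R}^n:(\mathbf{x}-\mathbf{c})^T[I-\epsilon^2\mathbf{v}\mathbf{v}^T](\mathbf{x}-\mathbf{c})=a^2-c^2\}$ is a hyperboloid in $\mathbb{R}^n$ centered at $\mathbf{c}=(c_1,\dots,c_n)^T$, with axis vector $\mathbf{v}$ of unit length, eccentricity $\epsilon>1$, and parameters $a$ and $c$, and suppose $H\!P=\{\mathbf{x}\in\mathbb{R}^n:\mathbf{h}\cdot(\mathbf{x}-\mathbf{c})=\hat h\}$ is a hyperplane with $\|\mathbf{h}\|=1$. Let $\rho=\sqrt{1-(\mathbf{h}\cdot\mathbf{v})^2}$. Then: (i) $Q\cap H\!P$ is a hyperboloid of dimension $n-1$ if and only if $\epsilon\rho>1$; (ii) $Q\cap H\!P$ is an ellipsoid of dimension $n-1$ if and only if $\epsilon\rho<1$ and $\hat h^2\ge a^2(1-\rho^2\epsilon^2)$; (iii) $Q\cap H\!P$ is a paraboloid of dimension $n-1$ if and only if $\epsilon\rho=1$.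
   Context: Norms are Euclidean. The parameters of the hyperboloid $Q$ satisfy $0<a<c$ and $\epsilon=c/a$; $Q$ is the set of points whose distances to the two focal points $\mathbf{c}\pm c\mathbf{v}$ differ in absolute value by $2a$. Conic sections of dimension $n-1$ are taken inside a hyperplane $A$ of $\mathbb{R}^n$ and are symmetric about their major axis: - a hyperboloid (of two sheets) is a set $\{\mathbf{x}\in A: |\,\|\mathbf{q}_2-\mathbf{x}\|-\|\mathbf{q}_1-\mathbf{x}\|\,|=2\alpha\}$ with $\mathbf{q}_1,\mathbf{q}_2\in A$ and $0<2\alpha<\|\mathbf{q}_1-\mathbf{q}_2\|$; - an ellipsoid is a set $\{\mathbf{x}\in A:\|\mathbf{q}_2-\mathbf{x}\|+\|\mathbf{q}_1-\mathbf{x}\|=2\alpha\}$ with $\mathbf{q}_1,\mathbf{q}_2\in A$ (possibly equal), $\alpha>0$ and $2\alpha>\|\mathbf{q}_1-\mathbf{q}_2\|$; - a paraboloid is a set $\{\mathbf{x}\in A:\|\mathbf{q}_1-\mathbf{x}\|=\mathbf{w}\cdot(\mathbf{x}-\mathbf{q}_2)\}$ with $\mathbf{q}_1\neq\mathbf{q}_2$ in $A$ and $\mathbf{w}=(\mathbf{q}_1-\mathbf{q}_2)/\|\mathbf{q}_1-\mathbf{q}_2\|$.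
   Formalization: The statement is proved for n ≥ 3 (the classes overlap or degenerate for n ≤ 2); in (ii) the inequality is strict, since equality gives a single point; in (iii) the condition ĥ ≠ 0 is added, since ερ = 1 with ĥ = 0 gives an empty section. *)

(* Defs.v *)
From HB Require Import structures.
From mathcomp Require Import all_boot all_order all_algebra.
From mathcomp Require Import boolp classical_sets reals.

Set Implicit Arguments.
Unset Strict Implicit.
Unset Printing Implicit Defensive.

Import Order.TTheory GRing.Theory Num.Theory.

Local Open Scope ring_scope.
Local Open Scope classical_set_scope.

Definition dot (R : realType) (n : nat) (x y : 'cV[R]_n) : R :=
  (x^T *m y) 0 0.

(* The norm `|x| that MathComp-Analysis puts on matrices is the sup norm, so
   the Euclidean norm is defined separately. *)
Definition enorm (R : realType) (n : nat) (x : 'cV[R]_n) : R :=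
  Num.sqrt (dot x x).

Definition is_hyperplane (R : realType) (n : nat) (A : set 'cV[R]_n) : Prop :=
  exists (u : 'cV[R]_n) (k : R),
    u != 0 /\ A = [set x : 'cV[R]_n | dot u x = k].

(* The three conics below are (n-1)-dimensional: each one lies in some
   hyperplane A of R^n that also contains its points q1 and q2. *)
Definition is_hyperboloid (R : realType) (n : nat) (S : set 'cV[R]_n) : Prop :=
  exists (A : set 'cV[R]_n) (q1 q2 : 'cV[R]_n) (alpha : R),
    [/\ is_hyperplane A, A q1 /\ A q2,
        0 < 2 * alpha, 2 * alpha < enorm (q1 - q2) &
        S = [set x : 'cV[R]_n |
              A x /\ `| enorm (q2 - x) - enorm (q1 - x) | = 2 * alpha]].

Definition is_ellipsoid (R : realType) (n : nat) (S : set 'cV[R]_n) : Prop :=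
  exists (A : set 'cV[R]_n) (q1 q2 : 'cV[R]_n) (alpha : R),
    [/\ is_hyperplane A, A q1 /\ A q2,
        0 < alpha, enorm (q1 - q2) < 2 * alpha &
        S = [set x : 'cV[R]_n |
              A x /\ enorm (q2 - x) + enorm (q1 - x) = 2 * alpha]].

Definition is_paraboloid (R : realType) (n : nat) (S : set 'cV[R]_n) : Prop :=
  exists (A : set 'cV[R]_n) (q1 q2 : 'cV[R]_n),
    [/\ is_hyperplane A, A q1 /\ A q2, q1 != q2 &
        let w := (enorm (q1 - q2))^-1 *: (q1 - q2) in
        S = [set x : 'cV[R]_n | A x /\ enorm (q1 - x) = dot w (x - q2)]].

(* The equation is between 1 x 1 matrices, hence the scalar matrix on the
   right. *)
Definition quadric (R : realType) (n : nat) (ctr v : 'cV[R]_n) (eps a c : R) :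
    set 'cV[R]_n :=
  [set x : 'cV[R]_n |
    (x - ctr)^T *m (1%:M - eps ^+ 2 *: (v *m v^T)) *m (x - ctr) =
    (a ^+ 2 - c ^+ 2)%:M].

Definition hyperplane_at (R : realType) (n : nat) (ctr h : 'cV[R]_n)
    (hhat : R) : set 'cV[R]_n :=
  [set x : 'cV[R]_n | dot h (x - ctr) = hhat].

(* Main.v *)
(** Put [y = x - p] with [p = ctr + hhat h + (eps^2 t hhat / m) g], where
    [t = h.v], [g = v - t h] (so [|g| = rho]) and [m = 1 - eps^2 rho^2]. If
    [m <> 0], completing the square turns the section into [h.y = 0],
    [|y|^2 - eps^2 (v.y)^2 = (eps^2 - 1) (hhat^2 - a^2 m) / m], which is the
    equation of the conic with foci [p +- alpha eps g] as soon as the right-hand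
    side is [alpha^2 m]; if moreover [m > 0 >= hhat^2 - a^2 m], it has at most
    one solution. If [m = 0], the section is a paraboloid whose focus and
    directrix point differ by [eps^2 t hhat g], and it is empty for [hhat = 0].

    The three classes are disjoint: hyperboloids and paraboloids project onto a
    whole line orthogonal to their axis, ellipsoids are bounded; hyperboloids and
    ellipsoids have a centre of symmetry, paraboloids do not. *)
Require Import Defs.
From mathcomp Require Import all_boot all_order all_algebra.
From mathcomp Require Import boolp classical_sets reals.
From mathcomp Require Import ring lra.

Import Order.TTheory GRing.Theory Num.Theory.
Local Open Scope ring_scope.
Local Open Scope classical_set_scope.

(** * Euclidean inner product and norm *)

Section Dot.
Context {R : realType} {n : nat}.
Implicit Types x y z u f : 'cV[R]_n.

Lemma dotE x y : x^T *m y = (dot x y)%:M.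
Proof. exact: mx11_scalar. Qed.

Lemma dotC x y : dot x y = dot y x.
Proof. by rewrite /dot -{1}[y]trmxK -trmx_mul mxE. Qed.

Lemma dotDr x y z : dot x (y + z) = dot x y + dot x z.
Proof. by rewrite /dot mulmxDr mxE. Qed.

Lemma dotZr (k : R) x y : dot x (k *: y) = k * dot x y.
Proof. by rewrite /dot -scalemxAr mxE. Qed.

Lemma dotNr x y : dot x (- y) = - dot x y.
Proof. by rewrite -scaleN1r dotZr mulN1r. Qed.

Lemma dotDl x y z : dot (x + y) z = dot x z + dot y z.
Proof. by rewrite dotC dotDr !(dotC z). Qed.

Lemma dotZl (k : R) x y : dot (k *: x) y = k * dot x y.
Proof. by rewrite dotC dotZr dotC. Qed.

Lemma dotNl x y : dot (- x) y = - dot x y.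
Proof. by rewrite dotC dotNr dotC. Qed.

Definition dot_linE := (dotDl, dotDr, dotNl, dotNr, dotZl, dotZr).

Lemma dot_ge0 x : 0 <= dot x x.
Proof.
rewrite /dot mxE; apply: sumr_ge0 => i _.
by rewrite mxE -expr2 sqr_ge0.
Qed.

Lemma dot_eq0 x : (dot x x == 0) = (x == 0).
Proof.
apply/idP/eqP => [|->]; last by rewrite /dot mulmx0 mxE.
rewrite /dot mxE psumr_eq0 => [/allP x0|i _]; last by rewrite mxE -expr2 sqr_ge0.
apply/colP => i; rewrite mxE.
by have /eqP := x0 i (mem_index_enum i); rewrite mxE => /eqP; rewrite -expr2 sqrf_eq0 => /eqP.
Qed.

Lemma dot_gt0 x : x != 0 -> 0 < dot x x.
Proof. by move=> x0; rewrite lt_def dot_eq0 x0 dot_ge0. Qed.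

Lemma dot_CauchySchwarz x y : dot x y ^+ 2 <= dot x x * dot y y.
Proof.
have [->|x0] := eqVneq x 0.
  by rewrite /dot trmx0 !mul0mx !mxE expr0n mul0r.
have xx := dot_gt0 _ x0.
(* This vector is [dot x x] times the component of [y] orthogonal to [x]. *)
have := dot_ge0 (dot x x *: y - dot x y *: x).
have -> : dot (dot x x *: y - dot x y *: x) (dot x x *: y - dot x y *: x) =
          dot x x * (dot x x * dot y y - dot x y ^+ 2).
  by rewrite !dot_linE (dotC y x); ring.
by rewrite pmulr_rge0 // subr_ge0.
Qed.

Lemma enorm_ge0 x : 0 <= enorm x.
Proof. exact: sqrtr_ge0. Qed.

Lemma sqr_enorm x : enorm x ^+ 2 = dot x x.
Proof. by rewrite sqr_sqrtr ?dot_ge0. Qed.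

Lemma enormN x : enorm (- x) = enorm x.
Proof. by rewrite /enorm !dot_linE opprK. Qed.

Lemma enorm_gt0 x : x != 0 -> 0 < enorm x.
Proof. by move=> x0; rewrite sqrtr_gt0 dot_gt0. Qed.

Lemma enormZ (k : R) x : 0 <= k -> enorm (k *: x) = k * enorm x.
Proof.
by move=> k0; rewrite /enorm !dot_linE mulrA -expr2 sqrtrM ?sqr_ge0 // sqrtr_sqr ger0_norm.
Qed.

Lemma enorm_triangle x y : enorm (x + y) <= enorm x + enorm y.
Proof.
rewrite -ler_sqr ?nnegrE ?addr_ge0 ?enorm_ge0 // sqrrD !sqr_enorm !dot_linE (dotC y x).
suff : dot x y <= enorm x * enorm y by lra.
apply: le_trans (ler_norm _) _.
rewrite -ler_sqr ?nnegrE ?mulr_ge0 ?enorm_ge0 // exprMn !sqr_enorm.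
by rewrite -normrX ger0_norm ?sqr_ge0 // dot_CauchySchwarz.
Qed.

(** The n x 2 matrix with columns [u] and [f] has rank at most 2 < n, so its left kernel contains a
    nonzero row, which is then normalised. It provides a direction inside the hyperplane of a conic,
    orthogonal to its axis. *)
Lemma exists_orthonormal2 u f : (3 <= n)%N ->
  exists e, [/\ dot u e = 0, dot f e = 0 & dot e e = 1].
Proof.
move=> n3; pose M := row_mx u f.
have /rowV0Pn[r /sub_kermxP rM r0] : kermx M != 0.
  rewrite -mxrank_eq0 mxrank_ker subn_eq0 -ltnNge.
  by apply: leq_ltn_trans (rank_leq_col _) _.
have /eqP := rM; rewrite mul_mx_row -(row_mx0 _ 1 1 1) => /eqP/eq_row_mx[ru rf].
have r0' : r^T != 0 by rewrite trmx_eq0.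
exists ((enorm r^T)^-1 *: r^T).
have dot_r z : r *m z = 0 -> dot z ((enorm r^T)^-1 *: r^T) = 0.
  by rewrite dotZr dotC /dot trmxK => ->; rewrite mxE mulr0.
split; [exact: dot_r | exact: dot_r |].
rewrite dotZl dotZr -sqr_enorm mulrA -expr2 -exprMn mulVf ?expr1n //.
by rewrite gt_eqF ?enorm_gt0.
Qed.
End Dot.

Ltac vec_ring := apply/colP => i; rewrite !mxE; ring.

(** * Invariants and focal equations of the conics *)

Section Conics.
Context {R : realType} {n : nat}.
Implicit Types (S A : set 'cV[R]_n) (x p q : 'cV[R]_n).

Definition projects_onto_line S :=
  exists e, dot e e = 1 /\ forall r : R, exists2 x, S x & dot e x = r.

(** Here [s] is twice the centre; for foci [q1] and [q2] it is [q1 + q2]. *)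
Definition centrally_symmetric S := exists s, forall x, S x -> S (s - x).

Definition ebounded S := exists q M, forall x, S x -> dot (q - x) (q - x) <= M.

Lemma projects_onto_line_unbounded S : projects_onto_line S -> ~ ebounded S.
Proof.
move=> [e [e1 He]] [q [M HM]].
(* With this value [dot e (q - x) = M + 1], so expanding |q - x - e|^2 >= 0 gives |q - x|^2 >= 2M +
   1, too large for the bound [M >= 0]. *)
have [x /HM xM ex] := He (dot e q - M - 1).
have := dot_ge0 (q - x - e); move: xM; rewrite !dot_linE e1 ex ?(dotC _ e) ex.
have := dot_ge0 (q - x); rewrite !dot_linE.
lra.
Qed.

Lemma projects_onto_line_two_points S : projects_onto_line S ->
  exists x y, [/\ S x, S y & x != y].
Proof.
move=> [e [_ He]]; have [x Sx ex] := He 0; have [y Sy ey] := He 1.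
exists x, y; split=> //; apply: contra_eq_neq ey => <-.
by rewrite ex eq_sym oner_eq0.
Qed.

(** Reflection in the midpoint of the foci exchanges the two focal distances. *)
Lemma focal_symmetry A q1 q2 x : is_hyperplane A -> A q1 -> A q2 -> A x ->
  [/\ A (q1 + q2 - x), enorm (q2 - (q1 + q2 - x)) = enorm (q1 - x) &
      enorm (q1 - (q1 + q2 - x)) = enorm (q2 - x)].
Proof.
move=> [u [k [_ ->]]] /= A1 A2 Ax; split.
- by rewrite !dot_linE A1 A2 Ax; ring.
- by rewrite -enormN; congr enorm; vec_ring.
- by rewrite -enormN; congr enorm; vec_ring.
Qed.

Lemma hyperboloid_symmetric S : is_hyperboloid S -> centrally_symmetric S.
Proof.
move=> [A [q1 [q2 [al [hA [A1 A2] _ _ ->]]]]].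
exists (q1 + q2) => x /= [Ax].
by have [? -> ->] := focal_symmetry _ _ _ _ hA A1 A2 Ax; rewrite distrC.
Qed.

Lemma ellipsoid_symmetric S : is_ellipsoid S -> centrally_symmetric S.
Proof.
move=> [A [q1 [q2 [al [hA [A1 A2] _ _ ->]]]]].
exists (q1 + q2) => x /= [Ax].
by have [? -> ->] := focal_symmetry _ _ _ _ hA A1 A2 Ax; rewrite addrC.
Qed.

(* Both |d2 - d1| = 2 alpha and d1 + d2 = 2 alpha square to the equation below,
   since it is equivalent to
   ((d2 - d1)^2 - 4 alpha^2) ((d2 + d1)^2 - 4 alpha^2) = 0; the triangle
   inequality rules out one of the factors. *)
Lemma focal_product p f x (al : R) :
  (dot f (x - p) ^+ 2 = al ^+ 2 * (dot (x - p) (x - p) + dot f f - al ^+ 2)) <->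
  ((enorm (p - f - x) - enorm (p + f - x)) ^+ 2 - (2 * al) ^+ 2) *
  ((enorm (p - f - x) + enorm (p + f - x)) ^+ 2 - (2 * al) ^+ 2) = 0.
Proof.
have xE : x = p + (x - p) by vec_ring.
move: (x - p) xE => y ->.
have E1 : enorm (p + f - (p + y)) ^+ 2 = dot y y + dot f f - 2 * dot f y.
  rewrite (_ : _ - _ = f - y); last by vec_ring.
  by rewrite sqr_enorm !dot_linE (dotC y f); ring.
have E2 : enorm (p - f - (p + y)) ^+ 2 = dot y y + dot f f + 2 * dot f y.
  rewrite (_ : _ - _ = - (f + y)); last by vec_ring.
  by rewrite sqr_enorm !dot_linE (dotC y f); ring.
move: E1 E2; set d1 := enorm _; set d2 := enorm _ => E1 E2.
have -> : ((d2 - d1) ^+ 2 - (2 * al) ^+ 2) * ((d2 + d1) ^+ 2 - (2 * al) ^+ 2) =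
  (d2 ^+ 2 - d1 ^+ 2) ^+ 2 - 8 * al ^+ 2 * (d1 ^+ 2 + d2 ^+ 2) + 16 * al ^+ 4 by ring.
(* The product has become 16 times the difference of the two sides of the equation. *)
rewrite E1 E2; split => H; first nra.
lra.
Qed.

Lemma hyperboloid_equation p f x (al : R) : 0 < al -> al < enorm f ->
  `|enorm (p - f - x) - enorm (p + f - x)| = 2 * al <->
  dot f (x - p) ^+ 2 = al ^+ 2 * (dot (x - p) (x - p) + dot f f - al ^+ 2).
Proof.
move=> al0 alf; apply: iff_trans (iff_sym (focal_product p f x al)).
(* The foci are 2|f| > 2 [al] apart, so the factor with the sum cannot vanish. *)
have tri : 2 * enorm f <= enorm (p - f - x) + enorm (p + f - x).
  have := enorm_triangle (p + f - x) (- (p - f - x)); rewrite enormN.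
  rewrite (_ : _ - _ = 2 *: f); last by vec_ring.
  by rewrite enormZ // addrC.
split => [<-|/eqP]; first by rewrite real_normK ?num_real // subrr mul0r.
rewrite mulf_eq0 !subr_eq0 => /orP[|].
  by rewrite -real_normK ?num_real // eqrXn2 ?normr_ge0 ?mulr_ge0 ?(ltW al0) // => /eqP.
by rewrite eqrXn2 ?addr_ge0 ?enorm_ge0 ?mulr_ge0 ?(ltW al0) // => /eqP; lra.
Qed.

Lemma ellipsoid_equation p f x (al : R) : 0 < al -> enorm f < al ->
  enorm (p - f - x) + enorm (p + f - x) = 2 * al <->
  dot f (x - p) ^+ 2 = al ^+ 2 * (dot (x - p) (x - p) + dot f f - al ^+ 2).
Proof.
move=> al0 alf; apply: iff_trans (iff_sym (focal_product p f x al)).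
have f0 := enorm_ge0 f.
(* Now 2|f| < 2 [al], so it is the factor with the difference that cannot vanish. *)
have tri : `|enorm (p - f - x) - enorm (p + f - x)| <= 2 * enorm f.
  have t1 := enorm_triangle (p + f - x) (- 2 *: f).
  have t2 := enorm_triangle (p - f - x) (2 *: f).
  move: t1 t2; rewrite scaleNr enormN enormZ //.
  rewrite (_ : p + f - x - _ = p - f - x); last by vec_ring.
  rewrite (_ : p - f - x + _ = p + f - x); last by vec_ring.
  by move=> t1 t2; rewrite ler_norml; apply/andP; split; lra.
split => [<-|/eqP]; first by rewrite subrr mulr0.
rewrite mulf_eq0 !subr_eq0 => /orP[/eqP H|].
  suff : `|enorm (p - f - x) - enorm (p + f - x)| = 2 * al by lra.
  by apply/eqP; rewrite -(@eqrXn2 _ 2) ?normr_ge0 ?mulr_ge0 ?(ltW al0) // real_normK ?num_real // H.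
by rewrite eqrXn2 ?addr_ge0 ?enorm_ge0 ?mulr_ge0 ?(ltW al0) // => /eqP.
Qed.

(** * Conics in terms of their centre; extent of each class *)

Lemma focal_midpoint q1 q2 :
  exists p f, [/\ q1 = p + f, q2 = p - f & enorm (q1 - q2) = 2 * enorm f].
Proof.
exists (2^-1 *: (q1 + q2)), (2^-1 *: (q1 - q2)); split.
- by apply/colP => i; rewrite !mxE; field.
- by apply/colP => i; rewrite !mxE; field.
- by rewrite enormZ ?invr_ge0 // mulrA divff ?mul1r ?pnatr_eq0.
Qed.

(** For [e] orthogonal to the axis, every displacement along [e] can be compensated by a
    displacement along [f] that returns to the hyperboloid. *)
Lemma hyperboloid_onto S : (3 <= n)%N -> is_hyperboloid S -> projects_onto_line S.
Proof.
move=> n3 [A [q1 [q2 [al [[u [k [_ ->]]] [/= A1 A2] al0 alf ->]]]]].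
have [p [f [q1E q2E fE]]] := focal_midpoint q1 q2.
rewrite fE in alf; rewrite q1E q2E !dot_linE in A1 A2 *.
have {}al0 : 0 < al by lra.
have {}alf : al < enorm f by lra.
have uf : dot u f = 0 by lra.
have up : dot u p = k by lra.
have [e [ue fe e1]] := exists_orthonormal2 u f n3.
have alf2 : al ^+ 2 < dot f f by rewrite -sqr_enorm ltr_sqr ?nnegrE ?ltW // (lt_trans al0).
have f0 : 0 < dot f f by apply: le_lt_trans alf2; exact: sqr_ge0.
exists e; split=> // r; pose r' := r - dot e p.
(* Solves the focal equation at [p + sg f + r' e] for [sg]; the radicand is nonnegative because [al]
   < |f|. *)
pose sg := Num.sqrt (al ^+ 2 * (r' ^+ 2 + (dot f f - al ^+ 2)) / (dot f f * (dot f f - al ^+ 2))).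
have sgE : sg ^+ 2 * (dot f f * (dot f f - al ^+ 2)) = al ^+ 2 * (r' ^+ 2 + (dot f f - al ^+ 2)).
  have dl : 0 < dot f f - al ^+ 2 by rewrite subr_gt0.
  rewrite sqr_sqrtr; last first.
    by rewrite divr_ge0 // mulr_ge0 ?(ltW f0) ?(ltW dl) // ?sqr_ge0 // addr_ge0 ?sqr_ge0 ?(ltW dl).
  by rewrite divfK // mulf_neq0 ?gt_eqF.
exists (p + (sg *: f + r' *: e)); last first.
  by rewrite !dot_linE (dotC e f) fe e1 /r'; ring.
split => /=; first by rewrite !dot_linE uf ue up; ring.
apply/hyperboloid_equation => //.
rewrite addrAC subrr add0r !dot_linE (dotC e f) fe e1.
by move: sgE; nra.
Qed.

Lemma ellipsoid_ebounded S : is_ellipsoid S -> ebounded S.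
Proof.
move=> [A [q1 [q2 [al [_ _ _ _ ->]]]]].
exists q1, ((2 * al) ^+ 2) => x /= [_ <-].
rewrite -sqr_enorm ler_sqr ?nnegrE ?addr_ge0 ?enorm_ge0 //.
by rewrite lerDr enorm_ge0.
Qed.

Lemma ellipsoid_two_points S : (3 <= n)%N -> is_ellipsoid S ->
  exists x y, [/\ S x, S y & x != y].
Proof.
move=> n3 [A [q1 [q2 [al [[u [k [_ ->]]] [/= A1 A2] al0 alf ->]]]]].
have [p [f [q1E q2E fE]]] := focal_midpoint q1 q2.
rewrite fE in alf; rewrite q1E q2E !dot_linE in A1 A2 *.
have {}alf : enorm f < al by lra.
have uf : dot u f = 0 by lra.
have up : dot u p = k by lra.
have [e [ue fe e1]] := exists_orthonormal2 u f n3.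
have alf2 : dot f f < al ^+ 2 by rewrite -sqr_enorm ltr_sqr ?nnegrE ?enorm_ge0 ?ltW.
(* The semi-minor axis: [p + r e] and [p - r e] are the two points. *)
pose r := Num.sqrt (al ^+ 2 - dot f f).
have rE : r ^+ 2 = al ^+ 2 - dot f f by rewrite sqr_sqrtr //; lra.
have r0 : 0 < r by rewrite sqrtr_gt0; lra.
have mem s : s ^+ 2 = r ^+ 2 -> dot u (p + s *: e) = k /\
    enorm (p - f - (p + s *: e)) + enorm (p + f - (p + s *: e)) = 2 * al.
  move=> sE; split; first by rewrite !dot_linE ue up; ring.
  apply/ellipsoid_equation => //.
  rewrite addrAC subrr add0r !dot_linE fe e1.
  by move: sE; nra.
exists (p + r *: e), (p + (- r) *: e); split.
- exact: mem.
- by apply: mem; rewrite sqrrN.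
- apply/eqP => /(congr1 (dot e)); rewrite !dot_linE e1; lra.
Qed.

Lemma paraboloid_onto S : (3 <= n)%N -> is_paraboloid S -> projects_onto_line S.
Proof.
move=> n3 [A [q1 [q2 [[u [k [_ ->]]] [/= A1 A2] q12 ->]]]].
have [e [ue qe e1]] := exists_orthonormal2 u (q1 - q2) n3.
have d0 : 0 < enorm (q1 - q2) by rewrite enorm_gt0 // subr_eq0.
exists e; split=> // r; pose r' := r - dot e q2; set d := enorm (q1 - q2) in d0 *.
have dE : dot (q1 - q2) (q1 - q2) = d ^+ 2 by rewrite sqr_enorm.
(* At [q2 + sg (q1 - q2) + r' e] the squared focus-directrix equation reads (1 - sg)^2 d^2 + r'^2 =
   sg^2 d^2, which is linear in [sg]. Since [sg >= 0], the unsquared equation holds too. *)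
pose sg := (d ^+ 2 + r' ^+ 2) / (2 * d ^+ 2).
have sgE : sg * (2 * d ^+ 2) = d ^+ 2 + r' ^+ 2.
  by rewrite divfK // mulf_neq0 ?expf_neq0 ?gt_eqF.
have sg0 : 0 <= sg.
  by apply: divr_ge0; [apply: addr_ge0; exact: sqr_ge0 | rewrite pmulr_rge0 ?sqr_ge0].
exists (q2 + (sg *: (q1 - q2) + r' *: e)); last first.
  rewrite dotDr [dot e (_ + _)]dotDr dotZr (dotC e (q1 - q2)) qe dotZr e1 /r'; ring.
split => /=.
  rewrite dotDr [dot u (_ + _)]dotDr dotZr (dotZr r') ue [dot u (q1 - q2)]dotDr dotNr A1 A2; ring.
rewrite addrAC subrr add0r dotZl dotDr !dotZr qe dE mulr0 addr0.
rewrite mulrCA expr2 mulKf ?gt_eqF //.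
apply/eqP; rewrite -(@eqrXn2 _ 2) ?enorm_ge0 ?(mulr_ge0 sg0 (ltW d0)) //; apply/eqP.
rewrite sqr_enorm (_ : _ - _ = (1 - sg) *: (q1 - q2) - r' *: e); last by vec_ring.
rewrite dotDl !dotDr dotNl !dotNr !dotZl !dotZr dotNl dotZl (dotC e (q1 - q2)) qe e1 dE.
by move: sgE; nra.
Qed.

(** Every point satisfies w.(x - q2) >= 0, being a distance. Applied to [x] and to [s - x], this
    bounds w.(x - q2), hence the distance to the focus, although the paraboloid is unbounded. *)
Lemma paraboloid_asymmetric S : (3 <= n)%N -> is_paraboloid S -> ~ centrally_symmetric S.
Proof.
move=> n3 pS; have onto := paraboloid_onto _ n3 pS.
case: pS onto => A [q1 [q2 [_ _ _]]] /=; set w := _ *: _ => SE onto [s sym].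
apply: projects_onto_line_unbounded onto _.
exists q1, (dot w (s - q2 - q2) ^+ 2) => x Sx.
have := sym _ Sx; rewrite SE /= => -[_ E'].
move: Sx; rewrite SE /= => -[_ E].
have := enorm_ge0 (q1 - (s - x)); rewrite E' => W'.
have := enorm_ge0 (q1 - x); rewrite E => W.
rewrite -sqr_enorm E ler_sqr ?nnegrE //; move: W W'; rewrite !dotDr !dotNr; lra.
Qed.

(** * Recognising conics from their squared equations *)

Lemma is_hyperplane_dot (u : 'cV[R]_n) (k : R) :
  u != 0 -> is_hyperplane [set x | dot u x = k].
Proof. by move=> u0; exists u, k. Qed.

(** The squared focal equation shared by hyperboloids and ellipsoids with foci [p + f] and [p - f];
    comparing [al] with |f| decides which one it is. *)
Definition central_conic u p f (k al : R) : set 'cV[R]_n :=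
  [set x | dot u x = k /\
    dot f (x - p) ^+ 2 = al ^+ 2 * (dot (x - p) (x - p) + dot f f - al ^+ 2)].

Lemma enorm_foci p f : enorm ((p + f) - (p - f)) = 2 * enorm f.
Proof. by rewrite -enormZ //; congr enorm; vec_ring. Qed.

Lemma central_conic_hyperboloid u p f (k al : R) :
  u != 0 -> dot u p = k -> dot u f = 0 -> 0 < al -> al < enorm f ->
  is_hyperboloid (central_conic u p f k al).
Proof.
move=> u0 up uf al0 alf.
exists [set x | dot u x = k], (p + f), (p - f), al; split.
- exact: is_hyperplane_dot.
- by rewrite /= !dot_linE up uf; split; ring.
- by rewrite mulr_gt0.
- by rewrite enorm_foci ltr_pM2l.
- by apply/predeqP => x; split=> -[ux H]; split=> //; apply/hyperboloid_equation.
Qed.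

Lemma central_conic_ellipsoid u p f (k al : R) :
  u != 0 -> dot u p = k -> dot u f = 0 -> enorm f < al ->
  is_ellipsoid (central_conic u p f k al).
Proof.
move=> u0 up uf alf.
have al0 : 0 < al by apply: le_lt_trans alf; exact: enorm_ge0.
exists [set x | dot u x = k], (p + f), (p - f), al; split => //.
- exact: is_hyperplane_dot.
- by rewrite /= !dot_linE up uf; split; ring.
- by rewrite enorm_foci ltr_pM2l.
- by apply/predeqP => x; split=> -[ux H]; split=> //; apply/ellipsoid_equation.
Qed.

(** This is the focus-directrix equation with focus [q] and directrix point [q - f], squared and
    multiplied by |f|^2. *)
Lemma paraboloid_of_equation u q f (k : R) :
  u != 0 -> dot u q = k -> dot u f = 0 -> f != 0 ->
  is_paraboloid [set x | dot u x = k /\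
    dot f f * dot (q - x) (q - x) = (dot f f + dot f (x - q)) ^+ 2].
Proof.
move=> u0 uq uf f0; have d0 := enorm_gt0 _ f0.
have dE := sqr_enorm f; set d := enorm f in d0 dE.
exists [set x | dot u x = k], q, (q - f); split => //.
- exact: is_hyperplane_dot.
- by rewrite /= !dot_linE uq uf; split; ring.
- by rewrite -subr_eq0 opprB addrC subrK.
have -> : q - (q - f) = f by vec_ring.
apply/predeqP => x /=; split=> -[ux H]; split=> //; move: H; rewrite dotZl -/d.
  have -> : dot f (x - (q - f)) = dot f f + dot f (x - q) by rewrite !dot_linE; ring.
  rewrite -dE -(sqr_enorm (q - x)).
  have := enorm_ge0 (q - x); set D := enorm _; set V := dot f (x - q) => D0 H.
  have nn : 0 <= d ^+ 2 + V.
    (* If W := d + V / d were negative, Cauchy-Schwarz would give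
       D >= |V| / d = |W| + d > |W| = D. *)
    have := dot_CauchySchwarz f (q - x).
    have -> : dot f (q - x) = - V by rewrite /V !dot_linE; ring.
    rewrite -dE -(sqr_enorm (q - x)) -/D sqrrN H => CS.
    have : 0 < d ^+ 2 by rewrite exprn_gt0.
    nra.
  apply/eqP; rewrite -(@eqrXn2 _ 2) //; last by rewrite mulr_ge0 ?invr_ge0 ?(ltW d0).
  by rewrite exprMn -H exprVn mulKf // expf_neq0 ?gt_eqF.
move=> H; rewrite -(sqr_enorm (q - x)) H exprMn exprVn dE mulVKf ?dot_eq0 //.
by rewrite !dot_linE; ring.
Qed.

End Conics.

(** * The section of the quadric by the hyperplane *)

Section QuadricSection.
Context {R : realType} {n : nat} (ctr v h : 'cV[R]_n) (a c eps hhat : R).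
Hypotheses (ha : 0 < a) (hac : a < c) (heps : eps = c / a).
Hypotheses (hv : enorm v = 1) (hh : enorm h = 1).

Let t := dot h v.
(** The square of rho, and of the length of [g], the projection of [v] along [h]. *)
Let P := 1 - t ^+ 2.
Let m := 1 - eps ^+ 2 * P.
Let g := v - t *: h.
Let S := quadric ctr v eps a c `&` hyperplane_at ctr h hhat.

Let cE : c = eps * a.
Proof. by rewrite heps divfK ?gt_eqF. Qed.

Let eps1 : 1 < eps.
Proof. by rewrite heps ltr_pdivlMr ?mul1r. Qed.

Let eps2 : 1 < eps ^+ 2.
Proof. by rewrite exprn_egt1. Qed.

Let vv : dot v v = 1.
Proof. by rewrite -sqr_enorm hv expr1n. Qed.

Let hhE : dot h h = 1.
Proof. by rewrite -sqr_enorm hh expr1n. Qed.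

Let h0 : h != 0.
Proof. by rewrite -dot_eq0 hhE oner_eq0. Qed.

Let hg : dot h g = 0.
Proof. by rewrite /g !dot_linE hhE -/t; ring. Qed.

Let vg : dot v g = P.
Proof. by rewrite /g !dot_linE vv (dotC v h) -/t /P; ring. Qed.

Let gg : dot g g = P.
Proof. by rewrite {1}/g dotDl dotNl dotZl hg vg; ring. Qed.

Let P_ge0 : 0 <= P.
Proof. by rewrite -gg dot_ge0. Qed.

Lemma rho_enorm : Num.sqrt P = enorm g.
Proof. by rewrite /enorm gg. Qed.

(** Within the hyperplane directions [v] acts as [g]; Cauchy-Schwarz with [g] then gives the sharper
    constant [P] in place of 1. *)
Let gyE y : dot h y = 0 -> dot g y = dot v y.
Proof. by move=> hy; rewrite /g dotDl dotNl dotZl hy; ring. Qed.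

Lemma quadricE (x : 'cV[R]_n) : quadric ctr v eps a c x <->
  dot (x - ctr) (x - ctr) - eps ^+ 2 * dot v (x - ctr) ^+ 2 = a ^+ 2 - c ^+ 2.
Proof.
rewrite /quadric /=; move: (x - ctr) => y.
have -> : y^T *m (1%:M - eps ^+ 2 *: (v *m v^T)) *m y =
    (dot y y - eps ^+ 2 * dot v y ^+ 2)%:M.
  rewrite mulmxBr mulmx1 mulmxBl -scalemxAr -scalemxAl mulmxA -(mulmxA (y^T *m v)).
  by rewrite !dotE (dotC y v) -scalar_mxM scale_scalar_mx -raddfB expr2.
split => [|-> //].
by move=> /matrixP/(_ 0 0); rewrite !mxE eqxx !mulr1n.
Qed.

Lemma section_central_equation x p : m != 0 ->
  p = ctr + hhat *: h + (eps ^+ 2 * t * hhat / m) *: g ->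
  S x <-> dot h (x - p) = 0 /\
    dot (x - p) (x - p) - eps ^+ 2 * dot v (x - p) ^+ 2 =
      (eps ^+ 2 - 1) * (hhat ^+ 2 - a ^+ 2 * m) / m.
Proof.
move=> m0 pE.
have xE : x - ctr = x - p + (hhat *: h + (eps ^+ 2 * t * hhat / m) *: g).
  by rewrite pE; vec_ring.
rewrite /S /setI /hyperplane_at /= quadricE xE; move: (x - p) => y.
(* [ka] solves ka (1 - eps^2 P) = eps^2 t hhat, which cancels the terms linear in v.y. *)
set ka := _ / m.
have -> : dot h (y + (hhat *: h + ka *: g)) = dot h y + hhat.
  by rewrite !dotDr !dotZr hhE hg; ring.
have hyP : dot h y + hhat = hhat <-> dot h y = 0 by split; lra.
rewrite hyP [X in X <-> _]and_comm.
suff E : dot h y = 0 ->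
  dot (y + (hhat *: h + ka *: g)) (y + (hhat *: h + ka *: g)) -
    eps ^+ 2 * dot v (y + (hhat *: h + ka *: g)) ^+ 2 - (a ^+ 2 - c ^+ 2) =
  dot y y - eps ^+ 2 * dot v y ^+ 2 - (eps ^+ 2 - 1) * (hhat ^+ 2 - a ^+ 2 * m) / m.
  by split=> -[hy H]; split=> //; have := E hy; lra.
move=> hy; set d := _ + _ *: g; have dE : d = hhat *: h + ka *: g by [].
clearbody d.
have yd : dot y d = ka * dot v y.
  by rewrite dE dotDr !dotZr (dotC y h) (dotC y g) hy gyE //; ring.
have vd : dot v d = hhat * t + ka * P by rewrite dE dotDr !dotZr vg (dotC v h).
have dd : dot d d = hhat ^+ 2 + ka ^+ 2 * P.
  by rewrite dE dotDl !dotZl !dotDr !dotZr (dotC g h) hg gg hhE; ring.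
rewrite !dotDl !dotDr (dotC d y) yd vd dd cE /ka.
move: m0; rewrite /m /P => m0; field; exact: m0.
Qed.

Lemma section_central_conic : m != 0 -> 0 < hhat ^+ 2 - a ^+ 2 * m ->
  exists p (al : R), [/\ dot h p = dot h ctr + hhat, 0 < al &
    S = central_conic h p ((al * eps) *: g) (dot h ctr + hhat) al].
Proof.
move=> m0 L0.
pose p := ctr + hhat *: h + (eps ^+ 2 * t * hhat / m) *: g.
(* Chosen so that the constant term of the centred equation is [al^2 m]; the radicand is positive
   for either sign of [m]. *)
pose al := Num.sqrt ((eps ^+ 2 - 1) * (hhat ^+ 2 - a ^+ 2 * m) / m ^+ 2).
have al2_gt0 : 0 < (eps ^+ 2 - 1) * (hhat ^+ 2 - a ^+ 2 * m) / m ^+ 2.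
  by apply: divr_gt0; rewrite ?exprn_even_gt0 //; apply: mulr_gt0; rewrite // subr_gt0.
have al_gt0 : 0 < al by rewrite sqrtr_gt0.
have alE : (eps ^+ 2 - 1) * (hhat ^+ 2 - a ^+ 2 * m) / m = al ^+ 2 * m.
  by rewrite sqr_sqrtr ?ltW // expr2 invfM mulrA divfK.
have hp : dot h p = dot h ctr + hhat.
  by rewrite /p !dotDr !dotZr hhE hg; ring.
exists p, al; split=> //; apply/predeqP => x.
rewrite (section_central_equation x p m0 erefl) alE /central_conic /=.
have -> : dot h (x - p) = 0 <-> dot h x = dot h ctr + hhat.
  by rewrite dotDr dotNr hp; split; lra.
have al2 : al ^+ 2 != 0 by rewrite expf_neq0 ?gt_eqF.
(* On the hyperplane the focal equation is -al^2 times the section equation. *)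
suff E : dot h x = dot h ctr + hhat ->
  dot ((al * eps) *: g) (x - p) ^+ 2 - al ^+ 2 * (dot (x - p) (x - p) +
     dot ((al * eps) *: g) ((al * eps) *: g) - al ^+ 2) =
  - al ^+ 2 * (dot (x - p) (x - p) - eps ^+ 2 * dot v (x - p) ^+ 2 - al ^+ 2 * m).
  split=> -[hx H]; split=> //; have := E hx; first by rewrite H subrr mulr0 => /subr0_eq.
  rewrite H subrr => /esym/eqP; rewrite mulf_eq0 oppr_eq0 (negbTE al2) /=.
  by rewrite subr_eq0 => /eqP.
move=> hx; have hy : dot h (x - p) = 0 by rewrite dotDr dotNr hp hx subrr.
by rewrite !dotZl dotZr gyE // gg /m; ring.
Qed.

(** Hence the section has eccentricity eps |g| = eps rho. *)
Let enorm_f al : 0 < al -> enorm ((al * eps) *: g) = al * (eps * enorm g).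
Proof.
by move=> al0; rewrite enormZ ?mulrA // mulr_ge0 ?ltW // (lt_trans ltr01).
Qed.

Let mE : m = 1 - (eps * enorm g) ^+ 2.
Proof. by rewrite exprMn sqr_enorm gg. Qed.

Let er_ge0 : 0 <= eps * enorm g.
Proof. by rewrite mulr_ge0 ?enorm_ge0 // ltW // (lt_trans ltr01). Qed.

Lemma section_hyperboloid : 1 < eps * enorm g -> is_hyperboloid S.
Proof.
move=> er1; have m0 : m < 0 by rewrite mE subr_lt0 exprn_egt1.
(* Automatic since [m < 0]: the hyperbolic case puts no condition on [hhat]. *)
have L0 : 0 < hhat ^+ 2 - a ^+ 2 * m.
  by rewrite ltr_wpDl ?sqr_ge0 // -mulrN mulr_gt0 ?exprn_gt0 ?oppr_gt0.
have [p [al [hp al0 ->]]] := section_central_conic (ltr0_neq0 m0) L0.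
apply: central_conic_hyperboloid => //; first by rewrite dotZr hg mulr0.
by rewrite enorm_f // ltr_pMr.
Qed.

Lemma section_ellipsoid : eps * enorm g < 1 -> a ^+ 2 * m < hhat ^+ 2 ->
  is_ellipsoid S.
Proof.
move=> er1 L0; have m0 : 0 < m by rewrite mE subr_gt0 exprn_ilt1.
rewrite -subr_gt0 in L0.
have [p [al [hp al0 ->]]] := section_central_conic (lt0r_neq0 m0) L0.
apply: central_conic_ellipsoid => //; first by rewrite dotZr hg mulr0.
by rewrite enorm_f // gtr_pMr.
Qed.

(** With y = x - p, Cauchy-Schwarz gives m |y|^2 <= |y|^2 - eps^2 (v.y)^2 <= 0, and [m > 0] forces y
    = 0. *)
Lemma section_subsingleton : eps * enorm g < 1 -> hhat ^+ 2 <= a ^+ 2 * m ->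
  forall x y, S x -> S y -> x = y.
Proof.
move=> er1 L0; have m0 : 0 < m by rewrite mE subr_gt0 exprn_ilt1.
pose p := ctr + hhat *: h + (eps ^+ 2 * t * hhat / m) *: g.
suff xp x : S x -> x = p by move=> x y /xp -> /xp ->.
move=> /(section_central_equation x p (lt0r_neq0 m0) erefl)[hy H].
apply/eqP; rewrite -subr_eq0 -dot_eq0 eq_le dot_ge0 andbT.
have CS := dot_CauchySchwarz g (x - p); rewrite gyE // gg in CS.
have : (eps ^+ 2 - 1) * (hhat ^+ 2 - a ^+ 2 * m) / m <= 0.
  by rewrite pmulr_lle0 ?invr_gt0 // pmulr_rle0 ?subr_gt0 // subr_le0.
rewrite -H => {}H.
rewrite -(pmulr_rle0 _ m0) /m.
have : 0 <= eps ^+ 2 * (P * dot (x - p) (x - p) - dot v (x - p) ^+ 2).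
  by rewrite mulr_ge0 ?sqr_ge0 // subr_ge0.
lra.
Qed.

Lemma section_paraboloid : eps * enorm g = 1 -> hhat != 0 -> is_paraboloid S.
Proof.
move=> er1 hhat0; have m0 : m = 0 by rewrite mE er1; ring.
have eP : eps ^+ 2 * P = 1 by move: m0; rewrite /m; lra.
have t0 : t != 0.
  by apply/eqP => t0; move: eP eps2; rewrite /P t0 expr0n subr0 mulr1 => ->; rewrite ltxx.
have g0 : g != 0.
  by apply/eqP => g0; move: er1; rewrite g0 /enorm /dot mulmx0 mxE sqrtr0; lra.
have e0 : eps != 0 by rewrite gt_eqF // (lt_trans ltr01).
(* For x = ctr + hhat h + z the linear part of the section equation is -2 f.z; [f] is focus minus
   directrix point. *)
pose f := (eps ^+ 2 * t * hhat) *: g.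
have fn0 : eps ^+ 2 * t * hhat != 0 by rewrite !mulf_neq0 ?expf_neq0.
have f0 : f != 0 by rewrite scaler_eq0 negb_or fn0.
have hf : dot h f = 0 by rewrite dotZr hg mulr0.
have ffE : dot f f = (eps * t * hhat) ^+ 2.
  rewrite /f dotZl dotZr gg.
  by transitivity ((eps ^+ 2 * P) * (eps * t * hhat) ^+ 2); [ring | rewrite eP mul1r].
(* Places the focus on the axis so that the constant terms agree. *)
pose k := (hhat ^+ 2 + c ^+ 2 - a ^+ 2) / (2 * dot f f).
have kE : k * (2 * dot f f) = hhat ^+ 2 + c ^+ 2 - a ^+ 2.
  by rewrite divfK // mulf_neq0 ?dot_eq0 // pnatr_eq0.
pose q := ctr + hhat *: h + k *: f.
have hq : dot h q = dot h ctr + hhat by rewrite /q !dotDr (dotZr k) hf dotZr hhE; ring.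
rewrite (_ : S = [set x | dot h x = dot h ctr + hhat /\
    dot f f * dot (q - x) (q - x) = (dot f f + dot f (x - q)) ^+ 2]).
  exact: paraboloid_of_equation.
apply/predeqP => x; rewrite /S /setI /hyperplane_at /= quadricE.
have hxP : dot h (x - ctr) = hhat <-> dot h x = dot h ctr + hhat.
  by rewrite dotDr dotNr; split; lra.
rewrite -hxP [X in X <-> _]and_comm.
have ff0 : dot f f != 0 by rewrite dot_eq0.
(* On the hyperplane the paraboloid equation is |f|^2 times the section equation. *)
suff E : dot h (x - ctr) = hhat ->
  dot f f * dot (q - x) (q - x) - (dot f f + dot f (x - q)) ^+ 2 =
  dot f f * (dot (x - ctr) (x - ctr) - eps ^+ 2 * dot v (x - ctr) ^+ 2 - (a ^+ 2 - c ^+ 2)).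
  split=> -[hx H]; split=> //; have := E hx.
    by rewrite H subrr mulr0 => /subr0_eq.
  by rewrite H subrr => /esym/eqP; rewrite mulf_eq0 (negbTE ff0) subr_eq0 => /eqP.
move=> hx; have [z zE] : exists z, x = ctr + hhat *: h + z.
  by exists (x - (ctr + hhat *: h)); vec_ring.
have xc : x - ctr = hhat *: h + z by rewrite zE; vec_ring.
have xq : x - q = z - k *: f by rewrite zE /q; vec_ring.
have hz : dot h z = 0 by move: hx; rewrite xc dotDr dotZr hhE; lra.
have fz : dot f z = eps ^+ 2 * t * hhat * dot v z by rewrite dotZl gyE.
clearbody f k.
rewrite -[q - x]opprB xq xc !dotNl !dotNr opprK.
have -> : dot (z - k *: f) (z - k *: f) = dot z z - 2 * k * dot f z + k ^+ 2 * dot f f.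
  by rewrite !dotDl !dotDr !dotNl !dotNr !dotZl !dotZr (dotC z f); ring.
have -> : dot f (z - k *: f) = dot f z - k * dot f f by rewrite dotDr dotNr dotZr.
have -> : dot (hhat *: h + z) (hhat *: h + z) = dot z z + hhat ^+ 2.
  by rewrite !dotDl !dotDr !dotZl !dotZr (dotC z h) hz hhE; ring.
have -> : dot v (hhat *: h + z) = hhat * t + dot v z by rewrite dotDr dotZr (dotC v h).
have -> : a ^+ 2 - c ^+ 2 = hhat ^+ 2 - k * (2 * dot f f) by rewrite kE; ring.
by rewrite fz ffE; ring.
Qed.

(** By Cauchy-Schwarz eps^2 (v.y)^2 <= |y|^2 for y = x - ctr, so the quadric's left-hand side is
    nonnegative while a^2 - c^2 < 0. *)
Lemma section_empty : eps * enorm g = 1 -> hhat = 0 -> forall x, ~ S x.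
Proof.
move=> er1 hhat0 x; have m0 : m = 0 by rewrite mE er1; ring.
rewrite /S /setI /hyperplane_at /= hhat0 quadricE => -[H hy].
have CS := dot_CauchySchwarz g (x - ctr); rewrite gyE // gg in CS.
have : 0 <= eps ^+ 2 * (P * dot (x - ctr) (x - ctr) - dot v (x - ctr) ^+ 2).
  by rewrite mulr_ge0 ?sqr_ge0 // subr_ge0.
have : a ^+ 2 < c ^+ 2 by rewrite ltr_sqr ?nnegrE ?ltW // (lt_trans ha).
have eP : eps ^+ 2 * P = 1 by move: m0; rewrite /m; lra.
by rewrite mulrBr mulrA eP; lra.
Qed.
End QuadricSection.


(** The inequality in (ii) is strict because equality leaves a single point, and (iii) asks
    [hhat != 0] because the section is otherwise empty. For n = 2 hyperboloids and ellipsoids would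
    both be pairs of points on a line; [3 <= n] separates them. *)
Theorem mainTheorem1 (R : realType) (n : nat) (ctr v h : 'cV[R]_n)
    (a c eps hhat : R)
    (hn : (3 <= n)%N)
    (ha : 0 < a) (hac : a < c) (heps : eps = c / a)
    (hv : enorm v = 1) (hh : enorm h = 1) :
  let Q := quadric ctr v eps a c in
  let HP := hyperplane_at ctr h hhat in
  let rho := Num.sqrt (1 - dot h v ^+ 2) in
  [/\ is_hyperboloid (Q `&` HP) <-> 1 < eps * rho,
      is_ellipsoid (Q `&` HP) <->
        (eps * rho < 1 /\ a ^+ 2 * (1 - rho ^+ 2 * eps ^+ 2) < hhat ^+ 2) &
      is_paraboloid (Q `&` HP) <-> (eps * rho = 1 /\ hhat != 0)].

Proof.
move=> Q HP rho.
have rhoE := rho_enorm v h hv hh; rewrite -/rho in rhoE.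
have rho2 : rho ^+ 2 = 1 - dot h v ^+ 2.
  rewrite sqr_sqrtr // subr_ge0.
  by have := dot_CauchySchwarz h v; rewrite -!sqr_enorm hv hh !expr1n mulr1.
have mE : 1 - rho ^+ 2 * eps ^+ 2 = 1 - eps ^+ 2 * (1 - dot h v ^+ 2) by rewrite rho2 mulrC.
rewrite mE.
have hyp := section_hyperboloid ctr v h a c eps hhat ha hac heps hv hh.
have ell := section_ellipsoid ctr v h a c eps hhat ha hac heps hv hh.
have sub := section_subsingleton ctr v h a c eps hhat ha hac heps hv hh.
have par := section_paraboloid ctr v h a c eps hhat ha hac heps hv hh.
have emp := section_empty ctr v h a c eps hhat ha hac hv hh.
rewrite -rhoE -/Q -/HP in hyp ell sub par emp.
(* Outside the three listed cases the section has at most one point. *)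
have nondegenerate : (exists x y, [/\ (Q `&` HP) x, (Q `&` HP) y & x != y]) ->
  [\/ 1 < eps * rho, eps * rho < 1 /\ a ^+ 2 * (1 - eps ^+ 2 * (1 - dot h v ^+ 2)) < hhat ^+ 2 |
      eps * rho = 1 /\ hhat != 0].
  move=> [x [y [Sx Sy /eqP xy]]]; case: (ltgtP (eps * rho) 1) => er.
  - apply: Or32; split=> //; case: ltP => // L0.
    by case: xy; exact: sub.
  - exact: Or31.
  - apply: Or33; split=> //; apply/eqP => hh0.
    exact: emp er hh0 x Sx.
have hyp_ell : is_hyperboloid (Q `&` HP) -> ~ is_ellipsoid (Q `&` HP).
  move=> /(hyperboloid_onto _ hn)/projects_onto_line_unbounded + /ellipsoid_ebounded.
  by apply.
have hyp_par : is_hyperboloid (Q `&` HP) -> ~ is_paraboloid (Q `&` HP).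
  by move=> /hyperboloid_symmetric sym /(paraboloid_asymmetric _ hn); apply.
have ell_par : is_ellipsoid (Q `&` HP) -> ~ is_paraboloid (Q `&` HP).
  by move=> /ellipsoid_symmetric sym /(paraboloid_asymmetric _ hn); apply.
(* For each direct implication, a conic has two points, so one of the three cases holds; the two
   wrong ones would put the section in a disjoint class. *)
split; split.
- move=> H; have [//|[? ?]|[? ?]] :=
    nondegenerate (projects_onto_line_two_points _ (hyperboloid_onto _ hn H)).
  + by case: (hyp_ell H); exact: ell.
  + by case: (hyp_par H); exact: par.
- exact: hyp.
- move=> H; have [?|//|[? ?]] :=
    nondegenerate (ellipsoid_two_points _ hn H).
  + by case: (hyp_ell (hyp _) H).
  + by case: (ell_par H); exact: par.
- by move=> [? ?]; exact: ell.
- move=> H; have [?|[? ?]|//] :=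
    nondegenerate (projects_onto_line_two_points _ (paraboloid_onto _ hn H)).
  + by case: (hyp_par (hyp _) H).
  + by case: (ell_par (ell _ _) H).
- by move=> [? ?]; exact: par.
Qed.
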